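(* Let $\alpha_n$ be the minimal zero of $\phi_n(x)$, and for $n\ge2$ let $\beta_n,\gamma_n$ be the minimal zeros of $U^{\mathrm{e}}_n(x)$ and $S_n(x)$. Then $\alpha_0=1$, $\alpha_1=-\frac12$, and for $n\ge2$, $\alpha_n=\min\{\beta_n,\gamma_n\}$, which equals $\beta_n$ if $n$ is even and $\gamma_n$ if $n\ge3$ is odd.
   Context: $U_n(x)$ is the Chebyshev polynomial of the second kind ($U_n(\cos\theta)=\sin((n+1)\theta)/\sin\theta$), with $U_{-1}=0$. $\phi_n(x)=((n+1)x^2-3x-n)U_n(x)+(x+1)(U_{n-1}(x)+1)$. The partial Chebyshev polynomial $U^{\mathrm{e}}_n$ is the polynomial with $U^{\mathrm{e}}_n(\cos\theta)=\frac{\sin((n+1)\theta/2)}{\sin(\theta/2)}$ for even $n$ and $U^{\mathrm{e}}_n(\cos\theta)=\frac{\sin((n+1)\theta/2)}{\sin\theta}$ for odd $n$. For $n\ge0$, $S_{2n}(x)=(2nx+x+2n-1)U_n(x)-(2nx+3x+2n+1)U_{n-1}(x)$ and $S_{2n+1}(x)=2(2nx^2+2x^2+2nx-x-1)U_n(x)-2(2nx+3x+2n+1)U_{n-1}(x)$. *)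

(* Defs.v *)
From HB Require Import structures.
From mathcomp Require Import all_boot all_order all_algebra.
From mathcomp Require Import reals.
Set Implicit Arguments. Unset Strict Implicit. Unset Printing Implicit Defensive.
Import Order.TTheory GRing.Theory Num.Theory.
Local Open Scope ring_scope.

Section Defs.
Variable R : nzRingType.

(* Chebyshev polynomials of the second kind: U_0 = 1, U_1 = 2x,
   U_{n+2} = 2x U_{n+1} - U_n  (so U_n(cos t) = sin((n+1)t)/sin t). *)
Fixpoint chebU (n : nat) : {poly R} :=
  match n with
  | 0 => 1
  | m.+1 => match m with
            | 0 => 'X *+ 2
            | k.+1 => 'X *+ 2 * chebU m - chebU k
            end
  end.

Definition chebUprev (n : nat) : {poly R} :=
  if n is m.+1 then chebU m else 0.

Definition phiP (n : nat) : {poly R} :=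
  (n.+1%:R *: 'X^2 - 3%:R *: 'X - (n%:R)%:P) * chebU n
  + ('X + 1) * (chebUprev n + 1).

(* Partial Chebyshev polynomial U^e_n:
   n = 2m   : sin((2m+1)t/2)/sin(t/2) = U_m + U_{m-1};
   n = 2m+1 : sin((m+1)t)/sin t      = U_m. *)
Definition chebUe (n : nat) : {poly R} :=
  if odd n then chebU n./2 else chebU n./2 + chebUprev n./2.

Definition chebS (n : nat) : {poly R} :=
  let m := n./2 in
  let c := (m.*2)%:R : R in
  if odd n then
    2%:R *: ((c *: 'X^2 + 2%:R *: 'X^2 + c *: 'X - 'X - 1) * chebU m)
    - 2%:R *: ((c *: 'X + 3%:R *: 'X + (c + 1)%:P) * chebUprev m)
  else
    (c *: 'X + 'X + (c - 1)%:P) * chebU m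
    - (c *: 'X + 3%:R *: 'X + (c + 1)%:P) * chebUprev m.

End Defs.

Definition is_min_root (R : realDomainType) (p : {poly R}) (a : R) : Prop :=
  root p a /\ forall x, root p x -> a <= x.

(* Main.v *)
Require Import Defs.
From HB Require Import structures.
From mathcomp Require Import all_boot all_order all_algebra.
From mathcomp Require Import reals.
From mathcomp Require Import polyrcf ring lra.
Import Order.TTheory GRing.Theory Num.Theory.
Local Open Scope ring_scope.

(** Write [a = U_m(x)], [b = U_(m-1)(x)].  The doubling formulas for [U] and
    the Pell-type identity [a^2 - 2xab + b^2 = 1] give
    [phi_n = (x - 1) U^e_n S_n], and [S_n(1) = 0], so only the minimal zeros of
    [U^e_n] and [S_n] have to be compared.  After the reflection [y = -x], let
    [t] be the largest zero of [U_m - U_(m-1)].  By interlacing, [U_k >= 1] on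
    [[t, +oo)] for [k <= m], and telescoping
    [U_m - U_(m-1) = 1 - 2 (1 - y) sum_(k < m) U_k] gives [1 - t <= 1 / (m + 1)].
    For [n = 2m], [-t] is the minimal zero of [U^e_n], and the bound on [t]
    shows that [S_n(-y)] has no zero with [y > t].
    For [n = 2m + 1], [(-1)^m S_n(-t) = 2 U_m(t) ((2m + 2) t - 2m) (t - 1) <= 0]
    while [(-1)^m S_n(-1) > 0], so [S_n] has a zero in [[-1, -t]], which lies to
    the left of every zero of [U^e_n = U_m]. *)

(** * Chebyshev identities and the factorisation of [phiP] *)

Section ChebyshevIdentities.
Variable R : comNzRingType.
Implicit Types (m n : nat) (x : R).

Lemma horner_chebUS n x :
  (chebU R n.+1).[x] = 2%:R * x * (chebU R n).[x] - (chebUprev R n).[x].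
Proof. by case: n => [|n] /=; rewrite !hornerE; ring. Qed.

Lemma horner_chebUN n x :
  ((chebU R n).[- x] = (-1) ^+ n * (chebU R n).[x]) *
  ((chebUprev R n).[- x] = - (-1) ^+ n * (chebUprev R n).[x]).
Proof.
elim: n => [|n [IHu IHv]]; first by rewrite /= !hornerE; split; ring.
rewrite !horner_chebUS [chebUprev R n.+1]/= !IHu IHv exprS.
by split; ring.
Qed.

Lemma chebU_pell n x :
  (chebU R n).[x] ^+ 2 = 1 + 2%:R * x * (chebU R n).[x] * (chebUprev R n).[x]
    - (chebUprev R n).[x] ^+ 2.
Proof.
elim: n => [|n IHn]; first by rewrite /= !hornerE; ring.
by rewrite horner_chebUS [chebUprev R n.+1]/=; ring: IHn.
Qed.

Lemma horner_chebU_double m x :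
  ((chebU R m.*2).[x] = (chebU R m).[x] ^+ 2 - (chebUprev R m).[x] ^+ 2) *
  ((chebUprev R m.*2).[x] =
     2%:R * (chebUprev R m).[x] * ((chebU R m).[x] - x * (chebUprev R m).[x])).
Proof.
elim: m => [|m [IHu IHv]]; first by rewrite /= !hornerE; split; ring.
have E : (chebU R m.*2.+1).[x] =
    2%:R * (chebU R m).[x] * (x * (chebU R m).[x] - (chebUprev R m).[x]).
  by rewrite horner_chebUS IHu IHv; ring.
rewrite doubleS [chebUprev R m.*2.+2]/= [chebUprev R m.+1]/=.
rewrite (horner_chebUS m.*2.+1) (horner_chebUS m) [chebUprev R m.*2.+1]/= E IHu.
by split; ring.
Qed.

Lemma horner_chebU_doubleS m x : (chebU R m.*2.+1).[x] =
  2%:R * (chebU R m).[x] * (x * (chebU R m).[x] - (chebUprev R m).[x]).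
Proof. by rewrite horner_chebUS !horner_chebU_double; ring. Qed.

Lemma horner_chebUe_even m x :
  (chebUe R m.*2).[x] = (chebU R m).[x] + (chebUprev R m).[x].
Proof. by rewrite /chebUe odd_double doubleK !hornerE. Qed.

Lemma chebUe_odd m : chebUe R m.*2.+1 = chebU R m.
Proof. by rewrite /chebUe /= odd_double /= uphalf_double. Qed.

Lemma horner_chebS_even m x : let c := m.*2%:R in
  (chebS R m.*2).[x] = (c * x + x + c - 1) * (chebU R m).[x]
    - (c * x + 3%:R * x + c + 1) * (chebUprev R m).[x].
Proof. by rewrite /chebS odd_double doubleK !hornerE /=; ring. Qed.

Lemma horner_chebS_odd m x : let c := m.*2%:R in
  (chebS R m.*2.+1).[x] =
    2%:R * (c * x ^+ 2 + 2%:R * x ^+ 2 + c * x - x - 1) * (chebU R m).[x]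
    - 2%:R * (c * x + 3%:R * x + c + 1) * (chebUprev R m).[x].
Proof. by rewrite /chebS /= odd_double /= uphalf_double !hornerE /=; ring. Qed.

Lemma horner_phiP n x :
  (phiP R n).[x] = (x - 1) * (chebUe R n).[x] * (chebS R n).[x].
Proof.
(* After doubling, both sides are polynomials in [x], [U_m(x)] and [U_(m-1)(x)] that agree modulo
   the Pell identity. *)
rewrite -[n]odd_double_half; set m := n./2; have pell := chebU_pell m x.
case: (odd n); rewrite ?add1n ?add0n /phiP.
  rewrite chebUe_odd horner_chebS_odd.
  rewrite !(hornerD, hornerN, hornerC, hornerX, hornerXn, hornerZ, hornerM) [chebUprev R m.*2.+1]/=.
  rewrite horner_chebU_doubleS !horner_chebU_double.
  by ring: pell.
rewrite horner_chebUe_even horner_chebS_even.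
rewrite !(hornerD, hornerN, hornerC, hornerX, hornerXn, hornerZ, hornerM).
rewrite !horner_chebU_double.
by ring: pell.
Qed.

Lemma chebU_diff m x (D := fun k => (chebU R k).[x] - (chebUprev R k).[x]) :
  D m.+1 = D m - 2%:R * (1 - x) * (chebU R m).[x].
Proof. by rewrite /D horner_chebUS /=; ring. Qed.

End ChebyshevIdentities.

(** * Extremal zeros over a real closed field *)

Section ExtremalRoots.
Variable R : rcfType.
Implicit Types (p : {poly R}) (x y a : R).

Lemma min_root_exists p x : p != 0 -> root p x -> exists a, is_min_root p a.
Proof.
move=> p0 px; have /= rs := roots_on_rootsR p0.
have : x \in rootsR p by rewrite -rs px.
have : sorted <%R (rootsR p) by exact: sorted_roots.
case E: (rootsR p) => [|a s] //= sorted_s _; exists a; split.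
  by have := rs a; rewrite E mem_head in_itv.
move=> y py; have := rs y; rewrite py E inE /= => /esym/predU1P[->//|ys].
by have /allP/(_ _ ys)/ltW := order_path_min lt_trans sorted_s.
Qed.

(** The intermediate value theorem gives a zero beyond [x]; a nonpositive value to the right of the
    largest zero would produce a still larger one. *)
Lemma largest_root_above p x :
  p.[x] <= 0 -> (forall y, 1 <= y -> 0 < p.[y]) ->
  exists t, [/\ x <= t, t < 1, p.[t] = 0 & forall y, t < y -> 0 < p.[y]].
Proof.
move=> px p_gt0; have lt1 y : p.[y] <= 0 -> y < 1.
  by rewrite ltNge => py; apply/negP => /p_gt0; rewrite ltNge py.
have ivt y : p.[y] <= 0 -> exists2 r, y <= r & p.[r] = 0.
  move=> py; have y1 := ltW (lt1 _ py).
  have sgn : p.[y] <= 0 <= p.[1] by rewrite py ltW// p_gt0.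
  by have [r /andP[yr _] /rootP pr] := poly_ivt y1 sgn; exists r.
have [r xr pr] := ivt _ px.
(* Reflection turns the largest zero into a minimal one, whose existence is known. *)
have qE y : (p \Po - 'X).[y] = p.[- y] by rewrite horner_comp !hornerE.
have q0 : p \Po - 'X != 0.
  apply/eqP => q0; have := p_gt0 1 (lexx _).
  by have := qE (- 1); rewrite opprK q0 horner0 => <-; rewrite ltxx.
have [|a [/rootP]] := @min_root_exists _ (- r) q0.
  by apply/rootP; rewrite qE opprK.
rewrite qE => pa amin; exists (- a).
have tmax y : p.[y] = 0 -> y <= - a.
  by move=> py; rewrite lerNr amin //; apply/rootP; rewrite qE opprK.
split=> //; first exact/(le_trans xr)/tmax.
  by rewrite lt1 // pa.
move=> y ay; rewrite ltNge; apply/negP => /ivt[s ys /tmax].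
by rewrite leNgt (lt_le_trans ay ys).
Qed.

End ExtremalRoots.

(** * The largest zero of [U_m - U_(m-1)] *)

Section ChebyshevRoots.
Variable R : rcfType.
Implicit Types (m n k : nat) (x y t : R).

Lemma chebU_diff_ge1 n y : 1 <= y ->
  1 <= (chebU R n).[y] /\ 1 <= (chebU R n).[y] - (chebUprev R n).[y].
Proof.
move=> y1; elim: n => [|n [IHu IHd]]; first by rewrite /= !hornerE subr0.
have D1 : 1 <= (chebU R n.+1).[y] - (chebUprev R n.+1).[y].
  by rewrite chebU_diff; nra.
by split=> //; move: D1 => /=; lra.
Qed.

Lemma chebU_diff_le n y : y <= 1 ->
  (forall k, (k <= n)%N -> 1 <= (chebU R k).[y]) ->
  (chebU R n).[y] - (chebUprev R n).[y] <= 1 - 2%:R * (1 - y) * n%:R.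
Proof.
move=> y1; elim: n => [|n IHn] u1; first by rewrite /= !hornerE; lra.
have {}IHn := IHn (fun k kn => u1 k (leqW kn)).
have := u1 n (leqnSn _); rewrite chebU_diff -natr1; nra.
Qed.

(** Induction on [m]: at the old zero [t] the next difference equals [- 2 (1 - t) U_(m+1)(t) <= 0],
    so the new largest zero [s] satisfies [t <= s]. The old bounds persist beyond [s], and there
    [U_(m+2) >= U_(m+1) >= 1]. *)
Lemma chebU_diff_largest_root m : (0 < m)%N ->
  exists t : R, [/\ t < 1, (chebU R m).[t] = (chebUprev R m).[t],
    forall y, t < y -> (chebUprev R m).[y] < (chebU R m).[y] &
    forall y k, t <= y -> (k <= m)%N -> 1 <= (chebU R k).[y]].
Proof.
case: m => // m _; elim: m => [|m [t [t1 tr tD tU]]].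
  exists (1 / 2%:R); rewrite /= !hornerE; split; try lra.
    by move=> y; rewrite !hornerE; lra.
  by move=> y [|[|//]] /= ty _; rewrite !hornerE; lra.
pose D := chebU R m.+2 - chebUprev R m.+2.
have DE y : D.[y] = (chebU R m.+2).[y] - (chebUprev R m.+2).[y].
  by rewrite /D !hornerE.
have [||s [ts s1 /eqP]] := @largest_root_above _ D t.
- rewrite DE chebU_diff tr subrr sub0r oppr_le0.
  by have := tU t m.+1 (lexx _) (leqnn _); nra.
- by move=> y /(chebU_diff_ge1 m.+2)[_]; rewrite DE; lra.
rewrite DE subr_eq0 => /eqP Ds sD; exists s; split=> //.
  by move=> y /sD; rewrite DE subr_gt0.
move=> y k sy; rewrite leq_eqVlt => /predU1P[->|]; last first.
  exact/tU/(le_trans ts).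
have := tU y m.+1 (le_trans ts sy) (leqnn _).
have : 0 <= D.[y].
  by move: sy; rewrite le_eqVlt => /predU1P[<-|/sD/ltW//]; rewrite DE Ds subrr.
by rewrite DE [chebUprev R _]/=; lra.
Qed.

(** Odd [m]: parity forces a zero at [0]. Even [m = 2k]: [U_m = U_k^2 - U_(k-1)^2] vanishes where
    [U_k = U_(k-1)]. *)
Lemma chebU_has_root m : (0 < m)%N -> exists x, root (chebU R m) x.
Proof.
have [o|e] := boolP (odd m).
  move=> _; exists 0; apply/rootP; have := (horner_chebUN R m 0).1.
  by rewrite oppr0 -signr_odd o expr1; lra.
rewrite -[m]odd_double_half (negPf e) add0n double_gt0.
move=> /chebU_diff_largest_root[t [_ tr _ _]]; exists t; apply/rootP.
by rewrite horner_chebU_double tr subrr.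
Qed.

Lemma horner_chebU1 n :
  ((chebU R n).[1] = n%:R + 1) * ((chebUprev R n).[1] = n%:R).
Proof.
elim: n => [|n [IHu IHv]]; first by rewrite /= !hornerE; split; ring.
by rewrite horner_chebUS [chebUprev R n.+1]/= IHu IHv; split; ring.
Qed.

Lemma chebU_neq0 n : chebU R n != 0.
Proof.
apply/eqP => u0; have := (horner_chebU1 n).1.
by rewrite u0 horner0; have := ler0n R n; lra.
Qed.

(** This keeps the factor [x - 1] of [phiP] from contributing a zero below those of [chebS]. *)
Lemma chebS_root1 n : root (chebS R n) 1.
Proof.
apply/rootP; rewrite -[n]odd_double_half; case: (odd n).
  by rewrite add1n horner_chebS_odd !horner_chebU1 -muln2; ring.
by rewrite add0n horner_chebS_even !horner_chebU1 -muln2; ring.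
Qed.

(** * Comparing the zeros of [chebUe] and [chebS] after reflection *)

Lemma horner_chebS_evenN m y : (chebS R m.*2).[- y] = (-1) ^+ m *
  ((2%:R * m%:R - 1 - (2%:R * m%:R + 1) * y) * (chebU R m).[y] +
   (2%:R * m%:R + 1 - (2%:R * m%:R + 3%:R) * y) * (chebUprev R m).[y]).
Proof. by rewrite horner_chebS_even !horner_chebUN -muln2; ring. Qed.

Lemma horner_chebS_oddN m y : (chebS R m.*2.+1).[- y] = (-1) ^+ m * 2%:R *
  (((2%:R * m%:R + 2%:R) * y ^+ 2 - (2%:R * m%:R - 1) * y - 1) * (chebU R m).[y]
   + (2%:R * m%:R + 1 - (2%:R * m%:R + 3%:R) * y) * (chebUprev R m).[y]).
Proof. by rewrite horner_chebS_odd !horner_chebUN -muln2; ring. Qed.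

(** The telescoped bound at the zero [t] reads [2 (1 - t) m <= 1], and [m + 1 <= 2 m]. *)
Lemma chebU_diff_largest_root_ge m t : (0 < m)%N -> t < 1 ->
  (chebU R m).[t] = (chebUprev R m).[t] ->
  (forall k, (k <= m)%N -> 1 <= (chebU R k).[t]) ->
  (1 - t) * (m%:R + 1) <= 1.
Proof.
move=> m0 t1 tr tU; have := chebU_diff_le m t (ltW t1) tU.
by have : 1 <= m%:R :> R by [rewrite ler1n]; rewrite tr subrr; nra.
Qed.

Lemma chebUe_even_min_root m t :
  (chebU R m).[t] = (chebUprev R m).[t] ->
  (forall y, t < y -> (chebUprev R m).[y] < (chebU R m).[y]) ->
  is_min_root (chebUe R m.*2) (- t).
Proof.
have UeN y : (chebUe R m.*2).[- y] =
    (-1) ^+ m * ((chebU R m).[y] - (chebUprev R m).[y]).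
  by rewrite horner_chebUe_even !horner_chebUN; ring.
move=> tr tD; split; first by apply/rootP; rewrite UeN tr subrr mulr0.
move=> x /rootP; rewrite -[x]opprK UeN => /eqP.
rewrite mulf_eq0 signr_eq0 subr_eq0 lerN2 /= => /eqP xr.
by rewrite leNgt; apply/negP => /tD; rewrite xr ltxx.
Qed.

Lemma chebS_even_neq0 m t y : (0 < m)%N -> (1 - t) * (m%:R + 1) <= 1 ->
  t < y -> (chebUprev R m).[y] < (chebU R m).[y] ->
  (forall k, (k <= m)%N -> 1 <= (chebU R k).[y]) ->
  (chebS R m.*2).[- y] != 0.
Proof.
move=> m0 tge ty; rewrite horner_chebS_evenN mulf_eq0 signr_eq0 /=.
(* With [m] a successor, [chebUprev R m] is [U_k], so the lower bound also covers [b]. *)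
case: m m0 tge => // k _; set m := k.+1 => tge.
set a := (chebU R m).[y]; set b := (chebUprev R m).[y] => ba yU.
have b1 : 1 <= b by apply: yU; rewrite leqnSn.
have m1 : 1 <= m%:R :> R by rewrite ler1n.
rewrite lt_eqF //; set w := 1 - y.
have w1 : w * (m%:R + 1) < 1 by rewrite /w; nra.
(* This is minus the bracket, rewritten in [w]. For [w >= 0] both summands have a sign; for [w < 0]
   it is regrouped as [2 (a + b) - w (2 (m + 1) (a + b) - (a - b))]. *)
suff : 0 < 2%:R * (1 - w * (m%:R + 1)) * (a + b) + w * (a - b).
  by rewrite /w; lra.
have [w0|w0] := leP 0 w.
  apply: ltr_wpDr; first by rewrite mulr_ge0 // subr_ge0 ltW.
  by rewrite !mulr_gt0 ?subr_gt0 //; lra.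
have : 0 < - w * (2%:R * (m%:R + 1) * (a + b) - (a - b)).
  by rewrite mulr_gt0 ?oppr_gt0 //; nra.
by lra.
Qed.

Lemma phiP_min_root n b c : is_min_root (chebUe R n) b ->
  is_min_root (chebS R n) c -> is_min_root (phiP R n) (Num.min b c).
Proof.
move=> [br bmin] [cr cmin]; split.
  apply/rootP; rewrite horner_phiP.
  case: (leP b c) => _; last by rewrite (rootP cr) mulr0.
  by rewrite (rootP br) mulr0 mul0r.
move=> x /rootP/eqP; rewrite horner_phiP !mulf_eq0 subr_eq0 ge_min -orbA.
case/or3P => [/eqP-> | /bmin -> // | /cmin -> //]; last by rewrite orbT.
by rewrite (cmin _ (chebS_root1 n)) orbT.
Qed.

Lemma chebS_odd_root m t : t < 1 -> (1 - t) * (m%:R + 1) <= 1 ->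
  (chebU R m).[t] = (chebUprev R m).[t] -> 1 <= (chebU R m).[t] ->
  exists2 x, x <= - t & root (chebS R m.*2.+1) x.
Proof.
move=> t1 tge tr u1; pose p := - (-1) ^+ m *: chebS R m.*2.+1.
have pN y : p.[- y] = - 2%:R *
  (((2%:R * m%:R + 2%:R) * y ^+ 2 - (2%:R * m%:R - 1) * y - 1) * (chebU R m).[y]
   + (2%:R * m%:R + 1 - (2%:R * m%:R + 3%:R) * y) * (chebUprev R m).[y]).
  rewrite hornerZ horner_chebS_oddN !mulrA; congr (_ * _).
  by rewrite mulNr -expr2 sqrr_sign mulN1r.
(* The left value is [-4]; the right one is [4 (1 - t) (1 - (1 - t) (m + 1)) U_m(t)]. *)
have sgn : p.[- 1] <= 0 <= p.[- t].
  rewrite !pN !horner_chebU1 -tr; apply/andP; split; first by lra.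
  set u := (chebU R m).[t] in u1 *.
  have -> : 0 = 0 * u :> R by rewrite mul0r.
  have : 0 <= (1 - t) * (1 - (1 - t) * (m%:R + 1)) * u.
    by rewrite !mulr_ge0 ?subr_ge0 //; [exact: ltW | lra].
  by rewrite mul0r; nra.
have le1 : - 1 <= - t by rewrite lerN2 ltW.
have [x /andP[_ xt] px] := poly_ivt le1 sgn; exists x => //.
by move: px; rewrite rootZ // oppr_eq0 signr_eq0.
Qed.

End ChebyshevRoots.

Theorem mainTheorem18 (R : realType) :
  is_min_root (phiP R 0) 1 /\
  is_min_root (phiP R 1) (- (1 / 2%:R)) /\
  (forall n : nat, (2 <= n)%N ->
     exists beta gamma : R,
       [/\ is_min_root (chebUe R n) beta,
           is_min_root (chebS R n) gamma,
           is_min_root (phiP R n) (Num.min beta gamma),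
           (~~ odd n -> Num.min beta gamma = beta) &
           (odd n -> Num.min beta gamma = gamma)]).
Proof.
split.
  have E x : (phiP R 0).[x] = (x - 1) ^+ 2.
    rewrite /phiP /= !(hornerD, hornerN, hornerC, hornerX, hornerXn, hornerZ,
      hornerM); ring.
  split; first by apply/rootP; rewrite E subrr expr0n.
  by move=> x /rootP/eqP; rewrite E sqrf_eq0 subr_eq0 => /eqP->.
split.
  have E x : (phiP R 1).[x] = 2%:R * (x - 1) ^+ 2 * (2%:R * x + 1).
    rewrite /phiP /= !(hornerD, hornerN, hornerC, hornerX, hornerXn, hornerZ,
      hornerM, hornerMn); ring.
  split; first by apply/rootP; rewrite E; field.
  move=> x /rootP/eqP; rewrite E !mulf_eq0 pnatr_eq0 /= orbb subr_eq0.
  by case/orP => /eqP; lra.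
move=> n n2; have m0 : (0 < n./2)%N by rewrite half_gt0.
rewrite -[n]odd_double_half; move: (n./2) m0 => m m0.
have [t [t1 tr tD tU]] := chebU_diff_largest_root R m m0.
have tge := chebU_diff_largest_root_ge _ _ _ m0 t1 tr (tU _ ^~ (lexx t)).
have [b [br bmin]] : exists b, is_min_root (chebU R m) b.
  have [x xr] := chebU_has_root R m m0.
  exact: min_root_exists (chebU_neq0 R m) xr.
have Sneq0 y : t < y -> (chebS R m.*2).[- y] != 0.
  move=> ty; apply: (chebS_even_neq0 _ _ t) => //; first exact: tD.
  by move=> k; apply: tU; exact: ltW.
have [_|_] := boolP (odd n); rewrite ?add1n ?add0n /= odd_double /=.
  have [x xt xr] := chebS_odd_root _ _ _ t1 tge tr (tU _ _ (lexx t) (leqnn m)).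
  (* The value at [-1] is [4 (-1)^m]. *)
  have S0 : chebS R m.*2.+1 != 0.
    apply/eqP => S0; have := horner_chebS_oddN R m 1.
    rewrite S0 horner0 !horner_chebU1 => /esym/eqP.
    by rewrite !mulf_eq0 signr_eq0 pnatr_eq0 /= => /eqP; lra.
  have [g gmin] := min_root_exists _ _ _ S0 xr.
  have bE : is_min_root (chebUe R m.*2.+1) b by rewrite chebUe_odd.
  exists b, g; split=> // [|_]; first exact: phiP_min_root.
  apply/min_idPr/(le_trans (gmin.2 _ xr))/(le_trans xt).
  (* If [b < - t], then [- b > t] is a zero of [U_m] by parity, against [U_m >= 1] on [[t, +oo)]. *)
  rewrite lerNl leNgt; apply/negP => /ltW tb; have := tU _ m tb (leqnn m).
  by rewrite horner_chebUN (rootP br) mulr0 ler10.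
have S0 : chebS R m.*2 != 0.
  (* Since [t < 1], the polynomial is nonzero at [-1]. *)
  by apply/eqP => S0; have := Sneq0 _ t1; rewrite S0 horner0 eqxx.
have [g gmin] := min_root_exists _ _ _ S0 (chebS_root1 R _).
have tmin := chebUe_even_min_root _ _ _ tr tD.
exists (- t), g; split=> // [|_]; first exact: phiP_min_root.
apply/min_idPl; rewrite lerNl leNgt; apply/negP => /Sneq0.
by rewrite opprK (rootP gmin.1) eqxx.
Qed.
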